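(* For $g\in C^3(\mathbb R^d)$ with bounded second derivatives, let $\tilde\Phi_g:\mathbb H\to\mathbb R$ be $\tilde\Phi_g(x)=\int_\Omega g(x(\omega))\,d\omega$. Then $$C^2(\mathbb H)\cap\big\{\tilde\Phi_g\;:\;g\in C^3(\mathbb R^d),\ \|D^2g\|_{L^\infty}<\infty,\ \|D^3g\|_{L^\infty}<\infty,\ D^3g\not\equiv0\big\}=\emptyset,$$ and so $$C^2(\mathbb H)\cap\big\{\tilde\Phi_g\;:\;g\in C^3(\mathbb R^d),\ \|D^2g\|_{L^\infty}<\infty,\ \|D^3g\|_{L^\infty}<\infty\big\}$$ is a finite dimensional space.
   Context: $\Omega=(0,1)^d$ with Lebesgue measure, $\mathbb H=L^2(\Omega;\mathbb R^d)$, and $C^2(\mathbb H)$ is the set of twice continuously Fréchet differentiable functions $\mathbb H\to\mathbb R$. *)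

(* Defs.v *)
From HB Require Import structures.
From mathcomp Require Import all_boot all_order all_algebra.
From mathcomp Require Import ring lra.
From mathcomp Require Import all_classical all_reals all_analysis.

Set Implicit Arguments.
Unset Strict Implicit.
Unset Printing Implicit Defensive.

Import Order.TTheory GRing.Theory Num.Def Num.Theory.
Import numFieldNormedType.Exports.

Local Open Scope classical_set_scope.
Local Open Scope ring_scope.

Section lebesgue_measure_tuple.
Variable R : realType.
Local Notation RM := (measurableTypeR R).

Section step.
Variables (n : nat) (m : {sigma_finite_measure set (n.-tuple RM) -> \bar R}).

Definition tcons (p : RM * n.-tuple RM) : n.+1.-tuple RM :=
  [the n.+1.-tuple RM of p.1 :: p.2].

Lemma measurable_tcons : measurable_fun [set: RM * n.-tuple RM] tcons.
Proof. exact: measurable_cons. Qed.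

Definition leb_step : set (n.+1.-tuple RM) -> \bar R :=
  pushforward (@lebesgue_measure R \x m)%E tcons.

Let leb_step0 : leb_step set0 = 0%E.
Proof. by rewrite /leb_step /pushforward preimage_set0 measure0. Qed.

Let leb_step_ge0 A : (0 <= leb_step A)%E.
Proof. by apply: integral_ge0 => x _; exact: measure_ge0. Qed.

Let leb_step_sigma_additive : semi_sigma_additive leb_step.
Proof.
move=> F mF tF mUF; rewrite /leb_step /pushforward preimage_bigcup.
apply: measure_semi_sigma_additive.
- by move=> k; rewrite -[X in measurable X]setTI; exact: measurable_tcons.
- apply/trivIsetP => i j _ _ ij.
  rewrite -preimage_setI; move/trivIsetP: tF => /(_ i j Logic.I Logic.I ij) ->.
  by rewrite preimage_set0.
- by rewrite -preimage_bigcup -[X in measurable X]setTI; exact: measurable_tcons.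
Qed.

HB.instance Definition _ := isMeasure.Build _ _ _ leb_step
  leb_step0 leb_step_ge0 leb_step_sigma_additive.

Let leb_step_sigma_finite : sigma_finite setT leb_step.
Proof.
have /sigma_finiteP[F [TF ndF Foo]] := sigma_finiteT (@lebesgue_measure R).
have /sigma_finiteP[G [TG ndG Goo]] := sigma_finiteT m.
pose uns (t : n.+1.-tuple RM) : RM * n.-tuple RM :=
  (thead t, [tuple of behead t]).
have muns : measurable_fun setT uns.
  apply/measurable_fun_pairP; split; last exact: measurable_behead.
  exact: measurable_tnth.
have tconsK : cancel tcons uns.
  by move=> [x t]; rewrite /uns /tcons/=; congr pair; apply/val_inj.
exists (fun k => uns @^-1` (F k `*` G k)).
  apply/seteqP; split => // t _.
  have [i _ Fi] : (\bigcup_i F i) (uns t).1 by rewrite -TF.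
  have [j _ Gj] : (\bigcup_i G i) (uns t).2 by rewrite -TG.
  exists (maxn i j) => //; split => /=.
    by move: Fi; exact/subsetPset/ndF/leq_maxl.
  by move: Gj; exact/subsetPset/ndG/leq_maxr.
move=> k; have [mF Fk] := Foo k; have [mG Gk] := Goo k; split.
  by rewrite -[X in measurable X]setTI; apply: muns => //; exact: measurableX.
rewrite /leb_step /pushforward -comp_preimage.
have -> : uns \o tcons = id by apply/funext => p /=; rewrite tconsK.
by rewrite preimage_id product_measure1E// lte_mul_pinfty// ge0_fin_numE.
Qed.

HB.instance Definition _ :=
  Measure_isSigmaFinite.Build _ _ _ leb_step leb_step_sigma_finite.

End step.

(* Lebesgue measure on R^n: the n-fold product of the Lebesgue measure on R,
   pushed forward along R * R^n ~ R^n.+1. *)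
Fixpoint lebesgue_tuple (n : nat) :
    {sigma_finite_measure set (n.-tuple RM) -> \bar R} :=
  match n with
  | 0 => dirac [tuple]
  | n'.+1 => leb_step (lebesgue_tuple n')
  end.

Definition cube n : set (n.-tuple RM) := [set w | forall i, 0 < tnth w i < 1].

Lemma measurable_cube n : measurable (@cube n).
Proof.
rewrite (_ : @cube n = \bigcap_(i in [set: 'I_n])
    ((@tnth n RM ^~ i) @^-1` `]0, 1[%classic)).
  apply: fin_bigcap_measurable => // i _.
  by rewrite -[X in measurable X]setTI; exact: measurable_tnth.
by apply/seteqP; split => w /= cw i => [_|]; have := cw i; rewrite /= in_itv/=;
  apply.
Qed.

Definition lebesgue_cube n : {measure set (n.-tuple RM) -> \bar R} :=
  mrestr (lebesgue_tuple n) (@measurable_cube n).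

End lebesgue_measure_tuple.

Section L2_space.
Context d (T : measurableType d) (R : realType).
Variables (mu : {measure set T -> \bar R}) (n : nat).

(* An R^n-valued function is measurable iff its coordinates are, and
   |x|^2 is integrable iff each coordinate is square-integrable. *)
Definition sq_integrable : {pred T -> 'rV[R]_n} :=
  mem [set x : T -> 'rV[R]_n | forall i, (fun t => x t 0 i) \in Lfun mu 2%:E].

Lemma sq_integrable_submod_closed : submod_closed sq_integrable.
Proof.
have [L0 Ll] := @Lfun_submod_closed _ T R mu 2%:E (lee1n 2).
split; rewrite ?inE/=.
  by move=> i; under eq_fun do rewrite mxE; exact: L0.
move=> a x y /[!inE]/= xL yL i.
by under eq_fun do rewrite !mxE; exact: Ll.
Qed.

HB.instance Definition _ := GRing.isSubmodClosed.Build _ _ sq_integrable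
  sq_integrable_submod_closed.

Record L2fun := MkL2fun {
  L2fun_val :> T -> 'rV[R]_n ; _ : L2fun_val \in sq_integrable }.

HB.instance Definition _ := [isSub for L2fun_val].
HB.instance Definition _ := [Choice of L2fun by <:].
HB.instance Definition _ := [SubChoice_isSubLmodule of L2fun by <:].

Implicit Types x y z : L2fun.

Lemma L2fun_coord x i : (fun t => x t 0 i) \in Lfun mu 2%:E.
Proof. by case: x => x /= /[!inE]/=; exact. Qed.

Lemma L2funDE x y t : (x + y) t = x t + y t. Proof. by []. Qed.
Lemma L2funBE x y t : (x - y) t = x t - y t. Proof. by []. Qed.
Lemma L2funZE a x t : (a *: x) t = a *: x t. Proof. by []. Qed.

Definition ae_null : {pred L2fun} := mem [set x : L2fun | \forall t \ae mu, x t = 0].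

Lemma ae_null_zmod_closed : zmod_closed ae_null.
Proof.
split; rewrite ?inE/=; first exact: nearW.
move=> x y /[!inE]/= x0 y0; near=> t.
rewrite -[LHS]/(x t - y t).
by rewrite (near x0 t)// (near y0 t)// subrr.
Unshelve. all: by end_near. Qed.

HB.instance Definition _ := GRing.isZmodClosed.Build _ ae_null
  ae_null_zmod_closed.

Definition inner x y : R := \int[mu]_t (\sum_i x t 0 i * y t 0 i).

Lemma inner_integrable x y :
  mu.-integrable setT (EFin \o (fun t => \sum_i x t 0 i * y t 0 i)).
Proof.
rewrite (_ : _ \o _ = fun t => \sum_i (x t 0 i * y t 0 i)%:E)%E; last first.
  by apply/funext => t; rewrite /= sumEFin.
apply: integrable_sum => // i _.
by apply/Lfun1_integrable/Lfun2_mul_Lfun1; exact: L2fun_coord.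
Qed.

Lemma innerC x y : inner x y = inner y x.
Proof.
by apply: eq_Rintegral => t _; apply: eq_bigr => i _; rewrite mulrC.
Qed.

Lemma innerDl x y z : inner (x + y) z = inner x z + inner y z.
Proof.
rewrite /inner -RintegralD//; [|exact: inner_integrable..].
apply: eq_Rintegral => t _; rewrite -big_split; apply: eq_bigr => i _.
by rewrite L2funDE mxE mulrDl.
Qed.

Lemma innerZl a x y : inner (a *: x) y = a * inner x y.
Proof.
rewrite /inner -RintegralZl//; last exact: inner_integrable.
apply: eq_Rintegral => t _; rewrite mulr_sumr; apply: eq_bigr => i _.
by rewrite L2funZE mxE mulrA.
Qed.

Lemma inner_ge0 x : 0 <= inner x x.
Proof.
by apply: Rintegral_ge0 => t _; apply: sumr_ge0 => i _; rewrite -expr2 sqr_ge0.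
Qed.

Lemma inner_eq0 x : inner x x = 0 -> x \in ae_null.
Proof.
have xx0 t : 0 <= \sum_i x t 0 i * x t 0 i.
  by apply: sumr_ge0 => i _; rewrite -expr2 sqr_ge0.
move=> x0; rewrite inE/=.
have /(ae_eq_integral_abs mu measurableT) h :=
  measurable_int _ (inner_integrable x x).
have : (\int[mu]_t `|(EFin \o fun t => (\sum_i x t 0%R i * x t 0%R i)%R) t| = 0)%E.
  under eq_integral do rewrite gee0_abs ?lee_fin//.
  rewrite -[LHS]fineK ?integrable_fin_num//; first by congr EFin.
  exact: inner_integrable.
move/h; apply: filterS => t /(_ Logic.I) /= [] /eqP.
rewrite psumr_eq0; last by move=> i _; rewrite -expr2 sqr_ge0.
move=> /allP xt0; apply/rowP => i; rewrite mxE.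
by have /= := xt0 i (mem_index_enum _); rewrite mulf_eq0 orbb => /eqP.
Qed.

Lemma inner_null x y : x \in ae_null -> inner x y = 0.
Proof.
rewrite inE /= => x0; rewrite /inner /Rintegral.
rewrite (ae_eq_integral (cst 0%E))//.
- by rewrite integral0.
- exact: measurable_int (inner_integrable x y).
- move: x0; apply: filterS => t /= -> _.
  by rewrite big1// => i _; rewrite mxE mul0r.
Qed.

Lemma CauchySchwarz_inner x y : inner x y ^+ 2 <= inner x x * inner y y.
Proof.
have [y0|y0] := eqVneq (inner y y) 0.
  by rewrite innerC (inner_null _ (inner_eq0 y0)) expr0n mulr_ge0 ?inner_ge0.
have {}y0 : 0 < inner y y by rewrite lt_def y0 inner_ge0.
have := inner_ge0 (inner y y *: x + (- inner x y) *: y).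
rewrite innerDl !innerZl ![inner _ (_ + _)]innerC !innerDl !innerZl.
rewrite (innerC y x) => h.
have {h} : 0 <= inner y y * (inner x x * inner y y - inner x y ^+ 2).
  by apply: le_trans h _; rewrite le_eqVlt; apply/orP; left; apply/eqP; ring.
by rewrite pmulr_rge0// subr_ge0.
Qed.

Local Open Scope quotient_scope.

Definition L2 := Quotient.quot ae_null.
HB.instance Definition _ := GRing.Zmodule.on L2.
HB.instance Definition _ := EqQuotient.on L2.

(* An element of L2 is used as a function through a representative. *)
Definition L2_fun (u : L2) : T -> 'rV[R]_n := repr u : L2fun.
Coercion L2_fun : L2 >-> Funclass.

Lemma L2_eqP x y : reflect (\forall t \ae mu, x t = y t) (\pi_L2 x == \pi_L2 y).
Proof.
rewrite -Quotient.idealrBE.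
have -> : (x - y \in ae_null) = `[< \forall t \ae mu, x t - y t = 0 >].
  by apply/idP/asboolP; rewrite inE.
apply: (iffP (asboolP _)); apply: filterS => t; first exact/subr0_eq.
by move=> ->; rewrite subrr.
Qed.

Definition L2scale (a : R) (u : L2) : L2 := \pi_L2 (a *: (repr u : L2fun)).

Lemma pi_scale a x : L2scale a (\pi_L2 x) = \pi_L2 (a *: x).
Proof.
apply/eqP/L2_eqP.
have /eqP/L2_eqP : \pi_L2 (repr (\pi_L2 x)) = \pi_L2 x by rewrite reprK.
by apply: filterS => t xt; rewrite !L2funZE xt.
Qed.

Let L2scalerA a b (u : L2) : L2scale a (L2scale b u) = L2scale (a * b) u.
Proof. by elim/quotW: u => x; rewrite (pi_scale b x) !pi_scale scalerA. Qed.

Let L2scale1r : left_id 1 L2scale.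
Proof. by elim/quotW=> x; rewrite pi_scale scale1r. Qed.

Let L2scalerDr : right_distributive L2scale +%R.
Proof.
move=> a; elim/quotW=> x; elim/quotW=> y.
by rewrite -pi_addr pi_scale scalerDr pi_addr -!pi_scale.
Qed.

Let L2scalerDl (u : L2) : {morph L2scale^~ u : a b / a + b}.
Proof.
by move=> a b; elim/quotW: u => x; rewrite pi_scale scalerDl pi_addr -!pi_scale.
Qed.

HB.instance Definition _ := GRing.Zmodule_isLmodule.Build R L2
  L2scalerA L2scale1r L2scalerDr L2scalerDl.

Definition L2norm (u : L2) : R := sqrtr (\int[mu]_t (\sum_i u t 0 i ^+ 2)).

Lemma L2norm_pi x : L2norm (\pi_L2 x) = sqrtr (inner x x).
Proof.
rewrite /L2norm -[RHS]/(sqrtr (\int[mu]_t (\sum_i x t 0 i * x t 0 i))).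
have /eqP/L2_eqP xx : \pi_L2 (repr (\pi_L2 x)) = \pi_L2 x by rewrite reprK.
rewrite (_ : Rintegral _ _ _ = inner (repr (\pi_L2 x)) (repr (\pi_L2 x))).
  congr (sqrtr (fine _)); apply: ae_eq_integral => //.
  - exact: measurable_int (inner_integrable _ _).
  - exact: measurable_int (inner_integrable _ _).
  - by move: xx; apply: filterS => t /= ->.
by apply: eq_Rintegral => t _; apply: eq_bigr => i _; rewrite expr2.
Qed.

Let L2normD (u v : L2) : L2norm (u + v) <= L2norm u + L2norm v.
Proof.
elim/quotW: u => x; elim/quotW: v => y; rewrite -pi_addr !L2norm_pi.
have [Ix Iy] := (inner_ge0 x, inner_ge0 y).
rewrite -(@ler_pXn2r _ 2)// ?nnegrE ?addr_ge0 ?sqrtr_ge0//.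
rewrite sqrrD !sqr_sqrtr ?inner_ge0//.
rewrite innerDl ![inner _ (x + y)]innerC !innerDl (innerC y x).
have : inner x y <= sqrtr (inner x x) * sqrtr (inner y y).
  rewrite -sqrtrM//; apply: le_trans (ler_norm _) _.
  by rewrite -sqrtr_sqr ler_wsqrtr// CauchySchwarz_inner.
lra.
Qed.

Let L2normZ a (u : L2) : L2norm (a *: u) = `|a| * L2norm u.
Proof.
elim/quotW: u => x; rewrite -[a *: _]/(L2scale a _) pi_scale !L2norm_pi innerZl innerC.
by rewrite innerZl mulrA -expr2 sqrtrM ?sqr_ge0// sqrtr_sqr.
Qed.

Let L2norm_eq0 (u : L2) : L2norm u = 0 -> u = 0.
Proof.
elim/quotW: u => x; rewrite L2norm_pi => /eqP; rewrite sqrtr_eq0 => x0.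
have /inner_eq0 : inner x x = 0 by apply/le_anti; rewrite x0 inner_ge0.
rewrite inE => ae0; rewrite -pi_zeror.
by apply/eqP/L2_eqP; move: ae0; apply: filterS => t /= ->.
Qed.

HB.instance Definition _ :=
  Lmodule_isNormed.Build R L2 L2normD L2normZ L2norm_eq0.

End L2_space.

Section frechet_C2.
Context (R : realType) (V : normedModType R).

(* f is differentiable, its differential V -> L(V, R) is differentiable with
   derivative D2 : V -> L(V, L(V, R)) for the operator norms, and D2 is
   continuous; the spaces of bounded (bi)linear maps are spelled out. *)
Definition frechet_C2 (f : V -> R) : Prop :=
  (forall x, differentiable f x) /\
  exists D2 : V -> V -> V -> R,
    [/\ forall x, [/\ forall k, linear (D2 x k : V -> R^o),
                      forall h, linear ((D2 x)^~ h : V -> R^o) &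
                      exists M, forall k h, `|D2 x k h| <= M * `|k| * `|h|],
        forall x (e : R), 0 < e -> \forall k \near (0 : V), forall h,
          `|'d f (x + k) h - 'd f x h - D2 x k h| <= e * `|k| * `|h| &
        forall x (e : R), 0 < e -> \forall y \near x, forall k h,
          `|D2 y k h - D2 x k h| <= e * `|k| * `|h|].

End frechet_C2.

Section partial_derivatives.
Context (R : realType) (n : nat).
Implicit Types g : 'rV[R]_n -> R.

(* pderiv [:: i; j; k] g = d_i (d_j (d_k g)) *)
Definition pderiv (s : seq 'I_n) g : 'rV[R]_n -> R :=
  foldr (fun i f => 'D_(delta_mx 0 i) f) g s.

Definition Ck (k : nat) g : Prop :=
  (forall s i x, (size s < k)%N -> derivable (pderiv s g) x (delta_mx 0 i)) /\
  (forall s, (size s <= k)%N -> continuous (pderiv s g)).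

(* D^k g (x) as the tensor of the k-th order partial derivatives at x *)
Definition Dtensor (k : nat) g (x : 'rV[R]_n) : {ffun k.-tuple 'I_n -> R} :=
  [ffun s => pderiv (val s) g x].

Definition tensor_norm (k : nat) (A : {ffun k.-tuple 'I_n -> R}) : R :=
  sqrtr (\sum_s A s ^+ 2).

Definition Linf_norm_D (k : nat) g : \bar R :=
  Lnorm (lebesgue_tuple R n) +oo%E
    (fun w => (tensor_norm (Dtensor k g (\row_i tnth w i)))%:E).

End partial_derivatives.

(* L^2(Omega; R^n) for Omega = (0,1)^n, where functions are defined on all of
   R^n but only matter up to null sets of the Lebesgue measure on Omega. *)
Notation L2cube R n := (L2 (lebesgue_cube R n) n).

(* The value does not depend on the representative of x, since g \o x is then
   changed on a null set only. *)
Definition Phi (R : realType) (n : nat) (g : 'rV[R]_n -> R) (x : L2cube R n) : R :=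
  \int[lebesgue_cube R n]_w g (x w).

(* S is the linear span of finitely many functions *)
Definition finite_dim_space (R : realType) (V : Type) (S : set (V -> R)) : Prop :=
  exists (m : nat) (e : 'I_m -> V -> R),
    S = [set f | exists c : 'I_m -> R, f = fun x => \sum_i c i * e i x].

(* Main.v *)
From HB Require Import structures.
Require Import Defs.
From mathcomp Require Import all_boot all_order all_algebra.
From mathcomp Require Import all_classical all_reals all_analysis.
From mathcomp Require Import measurable_realfun ess_sup_inf.
From mathcomp Require Import ring lra.
Set Implicit Arguments.
Unset Strict Implicit.
Unset Printing Implicit Defensive.
Import Order.TTheory GRing.Theory Num.Theory numFieldNormedType.Exports.
Local Open Scope classical_set_scope.
Local Open Scope ring_scope.

(* For v in R^d and A of measure m > 0 one has |v 1_A|^2 = m |v|^2 and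
   Phi g (v 1_A) - Phi g 0 = m (g v - g 0). The second order Taylor estimate of
   Phi g at 0 along v 1_A, divided by m, therefore says that g v differs by at
   most e |v|^2 from a quadratic polynomial in v, as soon as m is small with
   respect to e and v. Hence g is a pointwise limit of polynomials of degree at
   most 2, so it is one of them: D^3 g = 0, and Phi g is a combination of the
   Phi of the monomials. Conversely, such a Phi g is a constant plus bounded
   linear and bilinear terms. *)

(** * Constant plus bounded linear plus bounded bilinear terms: such functions are [C^2] *)

Section quadratic_functional.
Context {R : realType} {V : normedModType R}.
Variables (c : R) (L : V -> R^o) (B : V -> V -> R^o) (M : R).
Hypotheses (linL : linear L) (linBl : forall h, linear (B^~ h))
  (linBr : forall k, linear (B k)).
Hypotheses (M0 : 0 < M) (leL : forall h, `|L h| <= M * `|h|)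
  (leB : forall k h, `|B k h| <= M * `|k| * `|h|).

Let f (x : V) : R := c + L x + B x x.
Let df x h : R^o := L h + (B x h + B h x).

(** Bilinearity makes the expansion exact: the remainder is [B h h], of size at most [M * |h|^2], so
    [df x] can only be the differential. *)
Lemma quadratic_expand x h : f (h + x) = f x + df x h + B h h.
Proof.
have L2 : L (h + x) = L h + L x by have := linL 1 h x; rewrite !scale1r.
have B1 z : B (h + x) z = B h z + B x z.
  by have := linBl z 1 h x; rewrite !scale1r.
have B2 z : B z (h + x) = B z h + B z x.
  by have := linBr z 1 h x; rewrite !scale1r.
rewrite /f /df L2 B1 !B2; ring.
Qed.

Let df_linear x : linear (df x).
Proof.
move=> a u v; rewrite /df linL linBl linBr.
rewrite /GRing.scale/=; ring.
Qed.

Let dL x : {linear V -> R^o} :=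
  HB.pack (df x) (GRing.isLinear.Build _ _ _ _ _ (df_linear x)).

Let df_continuous x : continuous (dL x).
Proof.
(* On the unit ball, [M] bounds [L h], and [M * |x|] bounds each of [B x h] and [B h x]. *)
apply: bounded_linear_continuous; exists (M + 2 * M * `|x|); split.
  by apply: num_real.
move=> N hN; apply/nbhs_norm0P; exists 1 => //= h h1.
apply: le_trans (ltW hN); rewrite /dL/= /df.
apply: le_trans (ler_normD _ _) _; rewrite lerD//.
  by apply: le_trans (leL h) _; rewrite ger_pMr// ltW.
apply: le_trans (ler_normD _ _) _.
have Mx : 0 <= M * `|x| by rewrite mulr_ge0// ltW.
have M1 : `|B x h| <= M * `|x|.
  by apply: le_trans (leB _ _) _; rewrite ler_piMr// ltW.
have M2 : `|B h x| <= M * `|x|.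
  by apply: le_trans (leB _ _) _; rewrite mulrAC ler_piMr// ltW.
by rewrite -mulrA [2 * _]mulr_natl mulr2n lerD.
Qed.

Let diff_locally_quadratic x : f \o shift x = cst (f x) + dL x +o_ 0 id.
Proof.
(* For [|h| < e / M] the remainder satisfies [M * |h| * |h| <= e * |h|]. *)
apply/eqaddoP => e e0; apply/nbhs_norm0P; exists (e / M) => /=.
  by rewrite divr_gt0.
move=> h he; rewrite !fctE /= quadratic_expand.
rewrite [_ - _](_ : _ = B h h); last by rewrite /cst; ring.
apply: le_trans (leB _ _) _; apply: ler_wpM2r => //.
by rewrite mulrC -ler_pdivlMr// ltW.
Qed.

Lemma quadratic_diff x : 'd f x = df x :> (V -> R^o).
Proof. exact: (diff_unique (@df_continuous x) (@diff_locally_quadratic x)). Qed.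

Lemma quadratic_differentiable x : differentiable (f : V -> R^o) x.
Proof.
apply/diff_locallyP; rewrite quadratic_diff; split; first exact: df_continuous.
exact: diff_locally_quadratic.
Qed.

(** The differential is affine in the base point, so the second derivative is constant and both
    estimates bound an expression equal to 0. *)
Lemma quadratic_frechet_C2 : frechet_C2 f.
Proof.
split; first exact: quadratic_differentiable.
exists (fun _ k h => B k h + B h k); split.
- move=> _; split.
  + by move=> k a u v; rewrite linBl linBr /GRing.scale/=; ring.
  + by move=> k a u v; rewrite linBl linBr /GRing.scale/=; ring.
  exists (M + M) => k h; apply: le_trans (ler_normD _ _) _.
  by rewrite !mulrDl lerD// mulrAC.
- move=> x e e0; near=> k => h.
  rewrite !quadratic_diff /df.
  have -> : B (x + k) h = B x h + B k h.
    by have := linBl h 1 x k; rewrite !scale1r.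
  have -> : B h (x + k) = B h x + B h k.
    by have := linBr h 1 x k; rewrite !scale1r.
  rewrite [X in `|X|](_ : _ = 0); last by ring.
  by rewrite normr0 !mulr_ge0// ltW.
- move=> x e e0; near=> k => u v.
  by rewrite subrr normr0 !mulr_ge0// ltW.
Unshelve. all: by end_near. Qed.

End quadratic_functional.

(** * Second order Taylor estimate at a point *)

Section taylor.
Context {R : realType} {V : normedModType R} (f : V -> R).

(** The mean value theorem on the segment from [x] to [x + k] reduces the estimate for [f] to the
    assumed first order estimate for its differential at an intermediate point. *)
Lemma second_order_taylor (D2 : V -> V -> R) x (e r : R) :
  0 <= e ->
  (forall x, differentiable f x) ->
  (forall h, linear (D2^~ h : V -> R^o)) ->
  (forall k h, `|k| < r ->
    `|'d f (x + k) h - 'd f x h - D2 k h| <= e * `|k| * `|h|) ->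
  forall k, `|k| < r ->
    `|f (x + k) - f x - 'd f x k - 2^-1 * D2 k k| <= e * `|k| ^+ 2.
Proof.
move=> e0 fd lD2 he k kr.
(* Subtracting the quadratic expansion along the segment makes [phi 1 - phi 0] the Taylor remainder,
   while [dphi s] is the error of the differential at [x + s *: k], evaluated at [k]. *)
pose phi (s : R) : R := f (x + s *: k) - (s * 'd f x k + 2^-1 * s ^+ 2 * D2 k k).
pose dphi (s : R) : R := 'd f (x + s *: k) k - ('d f x k + s * D2 k k).
have phid (s : R) : is_derive s 1 phi (dphi s).
  have h1 : is_diff s (fun s : R => x + s *: k) (fun u => u *: k).
    apply: is_diff_eq; rewrite add0r; exact/funext.
  have h2 : is_diff s (f \o (fun s : R => x + s *: k))
      ('d f (x + s *: k) \o (fun u => u *: k)).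
    exact: is_diff_comp.
  have h3 : is_derive s 1 (f \o (fun s : R => x + s *: k)) ('d f (x + s *: k) k).
    apply: DeriveDef; first exact: diff_derivable.
    by rewrite deriveE// diff_val/= scale1r.
  rewrite /phi; apply: is_derive_eq.
  by rewrite /dphi /GRing.scale/=; field.
have [t t01] : exists2 t, t \in `[0, 1] & phi 1 - phi 0 = dphi t * (1 - 0).
  apply: MVT_segment => //.
  apply: derivable_within_continuous => t _.
  exact: ex_derive.
rewrite /phi /dphi !scale1r scale0r !addr0 expr0n expr1n/= !mulr0 !mul0r.
rewrite !addr0 !subr0 !mulr1 !mul1r => E.
have {E} -> : f (x + k) - f x - 'd f x k - 2^-1 * D2 k k =
    'd f (x + t *: k) k - 'd f x k - D2 (t *: k) k.
  have -> : D2 (t *: k) k = t * D2 k k.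
    have D20 : D2 0 k = 0.
      have := lD2 k (-1) 0 0; rewrite scaler0 add0r => ->.
      by rewrite scaleN1r addNr.
    by have := lD2 k t k 0; rewrite addr0 D20 addr0.
  lra.
move: t01; rewrite in_itv/= => /andP[t0 t1].
have tk : `|t *: k| <= `|k| by rewrite normrZ ger0_norm// ler_piMl.
apply: le_trans (he _ _ _) _; first exact: le_lt_trans kr.
by rewrite expr2 mulrA ler_wpM2r// ler_wpM2l.
Qed.

End taylor.

(** Measurability of [x] is known by coordinates only. The preimage of an open interval under [g] is
    open, hence a countable union of balls with rational centres; balls of the sup norm are boxes,
    and these pull back to finite intersections of coordinate conditions. *)
Lemma measurable_comp_continuous_rV d (T : measurableType d) (R : realType)
    (n : nat) (x : T -> 'rV[R]_n) (g : 'rV[R]_n -> R) :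
  (forall i, measurable_fun setT (fun t => x t 0 i)) -> continuous g ->
  measurable_fun setT (g \o x).
Proof.
move=> mx /continuousP cg; apply: (measurability _ (RGenOpens.measurableE R)).
move=> _ [_ [a [b ->] <-]]; rewrite setTI comp_preimage.
have : open (g @^-1` `]a, b[) by exact/cg/interval_open.
set O := g @^-1` _ => oO.
pose box (p : 'rV[rat]_n * nat) := ball (map_mx ratr p.1 : 'rV[R]_n) p.2.+1%:R^-1.
have -> : O = \bigcup_(p in [set p | box p `<=` O]) box p.
  apply/seteqP; split => [y Oy|y [p /=]]; last exact.
  have /nbhs_ballP[e /= e0 yO] : nbhs y O by exact: open_nbhs_nbhs.
  (* This gives [2 * r <= e]: a rational point within [r] of [y] has its [r]-ball inside the
     [e]-ball of [y]. *)
  pose m := Num.truncn (2 / e); pose r : R := m.+1%:R^-1.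
  have r0 : 0 < r by rewrite invr_gt0.
  have re : r + r <= e.
    have h : 2 / e < m.+1%:R by exact: truncnS_gt.
    rewrite /r -mulr2n -(mulr_natl _ 2) ler_pdivrMr// mulrC -ler_pdivrMr//.
    exact: ltW.
  have /choice[q qy] : forall i, exists q : rat, ball (y 0 i) r (ratr q).
    move=> i; have [|q qi] := @rat_in_itvoo _ (y 0 i - r) (y 0 i + r).
      by rewrite ltrD2l gtrN.
    exists q; rewrite /ball/= ltr_distlC; by move: qi; rewrite in_itv.
  have yq : ball y r (map_mx ratr (\row_i q i) : 'rV[R]_n).
    by split=> // i j; rewrite !mxE ord1.
  exists (\row_i q i, m); last exact: ball_sym.
  move=> z /= qz; apply: yO; apply: le_ball re _ _.
  exact: ball_triangle yq qz.
rewrite preimage_bigcup bigcup_mkcond.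
apply: countable_bigcupT_measurable => [|p]; first exact: countableP.
case: ifP => // _.
have -> : x @^-1` box p = \bigcap_(i in [set: 'I_n])
    ((fun t => x t 0 i) @^-1` ball (ratr (p.1 0 i) : R) p.2.+1%:R^-1).
  apply/seteqP; split => t /= H.
    by move=> i _; have [_ /(_ 0 i)] := H; rewrite mxE.
  split => [|i j]; first by rewrite invr_gt0.
  by rewrite mxE ord1; apply: H.
apply: fin_bigcap_measurable => // i _.
rewrite -[X in measurable X]setTI; apply: mx => //.
by apply: open_measurable; apply: ball_open; rewrite invr_gt0.
Qed.

(** * Integral functionals on [L2] and their values at step functions *)

Section L2_functional.
Context d (T : measurableType d) (R : realType).
Variables (mu : {measure set T -> \bar R}) (n : nat).
Hypothesis mufin : (mu setT < +oo)%E.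

Local Notation V := (L2 mu n).

Definition integral_functional (g : 'rV[R]_n -> R) (u : V) : R :=
  \int[mu]_t g (u t).

Lemma L2fun_measurable (x : L2fun mu n) i :
  measurable_fun setT (fun t => x t 0 i).
Proof. by have /sub_Lfun_mfun := L2fun_coord x i; rewrite inE. Qed.

(** Representatives agree almost everywhere; continuity of [g] gives the measurability needed to
    compare the two integrals. *)
Lemma integral_functional_pi (g : 'rV[R]_n -> R) (x : L2fun mu n) :
  continuous g ->
  integral_functional g (\pi_V%qT x) = \int[mu]_t g (x t).
Proof.
move=> cg; rewrite /integral_functional /L2_fun /Rintegral; congr fine.
have mg (y : L2fun mu n) : measurable_fun setT (EFin \o (fun t => g (y t))).
  apply/measurable_EFinP; apply: measurable_comp_continuous_rV => // i.
  exact: L2fun_measurable.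
apply: ae_eq_integral => //; [exact: mg|exact: mg|].
have /eqP/L2_eqP := reprK (\pi_V%qT x).
by apply: filterS => t /= ->.
Qed.

Lemma indic_Lfun2 (A : set T) : measurable A -> (\1_A : T -> R) \in Lfun mu 2%:E.
Proof.
move=> mA; rewrite inE/=; apply/andP; split; rewrite inE//=.
rewrite /finite_norm unlock poweR_lty//.
rewrite (_ : (fun x => _) = fun x => (\1_A x)%:E); last first.
  apply/funext => t /=; rewrite indicE.
  by case: (_ \in _); rewrite ?normr0 ?normr1 ?powR0// powR1.
rewrite integral_indic// setIT (le_lt_trans _ mufin)//.
by apply: le_measure => //; rewrite inE.
Qed.

Lemma cst_Lfun2 (c : R) : (fun=> c) \in Lfun mu 2%:E.
Proof.
rewrite (_ : (fun=> c) = c \o* \1_setT).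
  by apply: Lfun_scale; [rewrite ler1n|exact: indic_Lfun2].
by apply/funext => t /=; rewrite indicT mul1r.
Qed.

Lemma Lfun2_integrable (f : T -> R) :
  f \in Lfun mu 2%:E -> mu.-integrable setT (EFin \o f).
Proof.
move=> f2; apply/Lfun1_integrable; apply: Lfun_subset12 f2.
by rewrite ge0_fin_numE.
Qed.

Lemma indic_sq_integrable (A : set T) (v : 'rV[R]_n) : measurable A ->
  (fun t => \1_A t *: v) \in @sq_integrable _ T R mu n.
Proof.
move=> mA; rewrite inE => i.
rewrite (_ : (fun t => _) = v 0 i \o* \1_A).
  by apply: Lfun_scale; [rewrite ler1n|exact: indic_Lfun2].
by apply/funext => t; rewrite mxE.
Qed.

Definition indic_L2fun (A : set T) (mA : measurable A) (v : 'rV[R]_n) :=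
  MkL2fun (indic_sq_integrable v mA).

Definition indic_L2 (A : set T) (mA : measurable A) (v : 'rV[R]_n) : V :=
  \pi_V%qT (indic_L2fun mA v).

Lemma indic_L2_linear A (mA : measurable A) : linear (indic_L2 mA).
Proof.
move=> a v w; rewrite /indic_L2.
have -> : indic_L2fun mA (a *: v + w) = a *: indic_L2fun mA v + indic_L2fun mA w.
  apply: val_inj => /=; apply/funext => t /=.
  by rewrite -[RHS]/(a *: (\1_A t *: v) + \1_A t *: w) scalerDr !scalerA mulrC.
by rewrite pi_addr -pi_scale.
Qed.

(** The sum of squares is the squared Euclidean norm of [v], whereas the norm of ['rV[R]_n] is the
    sup norm. *)
Lemma indic_L2_norm A (mA : measurable A) v :
  `|indic_L2 mA v| ^+ 2 = fine (mu A) * \sum_i v 0 i ^+ 2.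
Proof.
rewrite [`|_|](L2norm_pi (indic_L2fun mA v)) sqr_sqrtr ?inner_ge0//.
rewrite /inner.
transitivity (\int[mu]_(t in A) (\sum_i v 0 i ^+ 2)).
  rewrite [RHS]Rintegral_mkcond; apply: eq_Rintegral => t _.
  rewrite patchE; case: ifPn => tA /=.
    by apply: eq_bigr => i _; rewrite mxE indicE tA mul1r expr2.
  by rewrite big1// => i _; rewrite mxE indicE (negbTE tA) mul0r mul0r.
by rewrite Rintegral_cst// mulrC.
Qed.

Lemma integral_functional_indic (g : 'rV[R]_n -> R) A (mA : measurable A) v :
  continuous g ->
  integral_functional g (indic_L2 mA v) =
  integral_functional g 0 + fine (mu A) * (g v - g 0).
Proof.
move=> cg.
(* Pointwise, [g (\1_B t *: v)] is [g 0 + (g v - g 0) * \1_B t]. The set is kept general because [B]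
   empty gives the value at the zero of [L2]. *)
have E (B : set T) (mB : measurable B) : integral_functional g (indic_L2 mB v) =
    g 0 * fine (mu setT) + (g v - g 0) * fine (mu B).
  rewrite /indic_L2 integral_functional_pi//.
  have mu0 : mu B \is a fin_num.
    by rewrite ge0_fin_numE// (le_lt_trans _ mufin)// le_measure// inE.
  transitivity (\int[mu]_t (g 0 + (g v - g 0) * \1_B t)).
    apply: eq_Rintegral => t _ /=; rewrite indicE; case: (_ \in _).
      by rewrite scale1r mulr1 addrC subrK.
    by rewrite scale0r mulr0 addr0.
  have i1 : mu.-integrable setT (EFin \o \1_B).
    exact/Lfun2_integrable/indic_Lfun2.
  rewrite RintegralD//; last 2 first.
    exact/Lfun2_integrable/cst_Lfun2.
    exact: (integrableZl measurableT (g v - g 0) i1).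
  by rewrite Rintegral_cst// RintegralZl// /Rintegral integral_indic// setIT.
have E0 : indic_L2 measurable0 v = 0.
  rewrite /indic_L2 -pi_zeror; congr (\pi_V%qT _).
  by apply: val_inj => /=; apply/funext => t /=; rewrite indic0 scale0r.
by rewrite -E0 !E measure0 /= mulr0 addr0 [_ * fine (mu A)]mulrC.
Qed.

End L2_functional.

(** * Polynomials of degree at most 2 and their recovery from finitely many values *)

Section poly2.
Context (R : realType) (n : nat).
Implicit Types (b : 'I_n -> R) (A : 'I_n -> 'I_n -> R) (x y v : 'rV[R]_n).

Definition linear_form b x : R := \sum_i b i * x 0 i.

Definition bilinear_form A x y : R := \sum_i \sum_j A i j * (x 0 i * y 0 j).

Definition poly2 c b A x : R := c + linear_form b x + bilinear_form A x x.

Lemma linear_form_linear b : linear (linear_form b : _ -> R^o).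
Proof.
move=> a x y; rewrite /linear_form scaler_sumr -big_split; apply: eq_bigr => i _.
by rewrite !mxE /GRing.scale/=; ring.
Qed.

Lemma bilinear_form_linearl A y : linear ((bilinear_form A)^~ y : _ -> R^o).
Proof.
move=> a x x'; rewrite /bilinear_form scaler_sumr -big_split; apply: eq_bigr => i _.
rewrite scaler_sumr -big_split; apply: eq_bigr => j _.
by rewrite !mxE /GRing.scale/=; ring.
Qed.

Lemma bilinear_form_linearr A x : linear (bilinear_form A x : _ -> R^o).
Proof.
move=> a y y'; rewrite /bilinear_form scaler_sumr -big_split; apply: eq_bigr => i _.
rewrite scaler_sumr -big_split; apply: eq_bigr => j _.
by rewrite !mxE /GRing.scale/=; ring.
Qed.

Lemma linear_form_delta b i : linear_form b (delta_mx 0 i) = b i.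
Proof.
rewrite /linear_form (bigD1 i)//= mxE !eqxx mulr1 big1 ?addr0// => j ji.
by rewrite mxE (negbTE ji) andbF mulr0.
Qed.

Lemma bilinear_form_deltal A i y :
  bilinear_form A (delta_mx 0 i) y = linear_form (A i) y.
Proof.
rewrite /bilinear_form (bigD1 i)//= [X in _ + X]big1 ?addr0 => [|k ki].
  by apply: eq_bigr => j _; rewrite mxE !eqxx mul1r.
by apply: big1 => j _; rewrite mxE (negbTE ki) andbF mul0r mulr0.
Qed.

Lemma bilinear_form_deltar A x j :
  bilinear_form A x (delta_mx 0 j) = linear_form (A^~ j) x.
Proof.
rewrite /bilinear_form /linear_form; apply: eq_bigr => i _.
rewrite (bigD1 j)//= [X in _ + X]big1 ?addr0 => [|k kj].
  by rewrite mxE !eqxx mulr1.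
by rewrite mxE (negbTE kj) andbF !mulr0.
Qed.

Lemma linear_rowE (h : 'rV[R]_n -> R^o) v :
  linear h -> h v = linear_form (fun i => h (delta_mx 0 i)) v.
Proof.
move=> hl; pose hL : {linear 'rV[R]_n -> R^o} :=
  HB.pack h (GRing.isLinear.Build _ _ _ _ _ hl).
rewrite -[h]/(hL : _ -> _) {1}(row_sum_delta v) linear_sum.
by apply: eq_bigr => i _; rewrite linearZ/= mulrC.
Qed.

Lemma bilinear_rowE (h : 'rV[R]_n -> 'rV[R]_n -> R^o) v w :
  (forall y, linear (h^~ y)) -> (forall x, linear (h x)) ->
  h v w = bilinear_form (fun i j => h (delta_mx 0 i) (delta_mx 0 j)) v w.
Proof.
move=> hl hr; rewrite (linear_rowE v (hl w)); apply: eq_bigr => i _.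
rewrite (linear_rowE w (hr _)) /linear_form mulr_suml.
by apply: eq_bigr => j _; rewrite mulrAC mulrA.
Qed.

(* Second-difference interpolation at 0: it reproduces polynomials of degree at
   most 2, and only uses finitely many values of g. *)
Definition interp2 (g : 'rV[R]_n -> R) : 'rV[R]_n -> R :=
  let e i : 'rV[R]_n := delta_mx 0 i in
  poly2 (g 0) (fun i => (g (e i) - g (- e i)) / 2)
    (fun i j => (g (e i + e j) - g (e i) - g (e j) + g 0) / 2).

(** The odd difference at [e i] and [- e i] cancels the quadratic part, and the mixed second
    difference cancels the constant and linear parts. *)
Lemma interp2_poly2 c b A : interp2 (poly2 c b A) = poly2 c b A.
Proof.
have L0 : linear_form b 0 = 0.
  by rewrite /linear_form big1// => i _; rewrite mxE mulr0.
have B0 y : bilinear_form A 0 y = 0.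
  by rewrite /bilinear_form big1// => i _; rewrite big1// => j _; rewrite mxE mul0r mulr0.
have LN x : linear_form b (- x) = - linear_form b x.
  by have := linear_form_linear b (-1) x 0; rewrite !scaleN1r L0 !addr0.
have LD x y : linear_form b (x + y) = linear_form b x + linear_form b y.
  by have := linear_form_linear b 1 x y; rewrite !scale1r.
have BDl x y z : bilinear_form A (x + y) z = bilinear_form A x z + bilinear_form A y z.
  by have := bilinear_form_linearl A z 1 x y; rewrite !scale1r.
have BDr x y z : bilinear_form A z (x + y) = bilinear_form A z x + bilinear_form A z y.
  by have := bilinear_form_linearr A z 1 x y; rewrite !scale1r.
have BN x : bilinear_form A (- x) (- x) = bilinear_form A x x.
  rewrite /bilinear_form; apply: eq_bigr => i _; apply: eq_bigr => j _.
  by rewrite !mxE mulrNN.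
apply/funext => x; rewrite /interp2 /poly2 L0 B0 !addr0; congr (_ + _ + _).
  apply: eq_bigr => i _; congr (_ * _).
  by rewrite BN LN linear_form_delta; field.
(* Values of the polynomial determine only the symmetric part of [A], which defines the same
   quadratic form. *)
transitivity (bilinear_form (fun i j => (A i j + A j i) / 2) x x).
  congr (bilinear_form _ x x); apply/funext => i; apply/funext => j.
  by rewrite LD BDl !BDr !bilinear_form_deltal !linear_form_delta; field.
transitivity (2^-1 * bilinear_form A x x + 2^-1 * bilinear_form (fun i j => A j i) x x).
  rewrite /bilinear_form !mulr_sumr -big_split; apply: eq_bigr => i _ /=.
  rewrite !mulr_sumr -big_split; apply: eq_bigr => j _ /=.
  by rewrite mulrDl mulrDl ![_ / 2]mulrC !mulrA.
have -> : bilinear_form (fun i j => A j i) x x = bilinear_form A x x.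
  rewrite /bilinear_form exchange_big /=; apply: eq_bigr => i _.
  by apply: eq_bigr => j _; rewrite [x 0 j * _]mulrC.
by field.
Qed.

Lemma poly2B c b A c' b' A' x :
  poly2 c b A x - poly2 c' b' A' x =
  poly2 (c - c') (fun i => b i - b' i) (fun i j => A i j - A' i j) x.
Proof.
rewrite /poly2 /linear_form /bilinear_form.
under [in RHS]eq_bigr do rewrite mulrBl.
rewrite [in RHS]sumrB.
under [X in _ = _ + X]eq_bigr => i _.
  under eq_bigr do rewrite mulrBl.
  rewrite sumrB.
over.
rewrite /= sumrB; ring.
Qed.

(** At a fixed point the value is controlled by the coefficients; this makes interpolation stable
    under small changes of the data. *)
Lemma poly2_bound c b A x (e : R) :
  `|c| <= e -> (forall i, `|b i| <= e) -> (forall i j, `|A i j| <= e) ->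
  `|poly2 c b A x| <=
    e * (1 + \sum_i `|x 0 i| + \sum_i \sum_j `|x 0 i * x 0 j|).
Proof.
move=> ce be Ae; rewrite !mulrDr mulr1.
apply: le_trans (ler_normD _ _) _; apply: lerD.
  apply: le_trans (ler_normD _ _) _; apply: lerD => //.
  apply: le_trans (ler_norm_sum _ _ _) _; rewrite mulr_sumr ler_sum// => i _.
  by rewrite normrM ler_wpM2r.
apply: le_trans (ler_norm_sum _ _ _) _; rewrite mulr_sumr ler_sum// => i _.
apply: le_trans (ler_norm_sum _ _ _) _; rewrite mulr_sumr ler_sum// => j _.
by rewrite normrM ler_wpM2r.
Qed.

(** If [q] is a polynomial close to [g] on [pts], then [interp2 q = q] gives [g v - interp2 g v = (g
    v - q v) - (interp2 g v - interp2 q v)], where both terms depend on values at [pts] only. Thus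
    [q] may change with the accuracy, and its coefficients need not converge. *)
Lemma poly2_limit (g : 'rV[R]_n -> R) :
  (forall (pts : seq 'rV[R]_n) (e : R), 0 < e -> exists c b A,
    forall p, p \in pts -> `|g p - poly2 c b A p| <= e) ->
  g = interp2 g.
Proof.
move=> gapprox; apply/funext => v.
pose e (i : 'I_n) : 'rV[R]_n := delta_mx 0 i.
(* The point [v] under study, together with all interpolation nodes. *)
pose pts := [:: v; 0] ++ [seq e i | i <- enum 'I_n] ++ [seq - e i | i <- enum 'I_n]
  ++ [seq e ij.1 + e ij.2 | ij <- enum ('I_n * 'I_n : finType)%type].
pose C : R := 1 + \sum_i `|v 0 i| + \sum_i \sum_j `|v 0 i * v 0 j|.
have C0 : 0 <= C.
  rewrite !addr_ge0 ?sumr_ge0// => i _; exact: sumr_ge0.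
have key (eps : R) : 0 < eps -> `|g v - interp2 g v| <= eps * (1 + 2 * C).
  move=> eps0; have [c [b [A qP]]] := gapprox pts _ eps0.
  set q := poly2 c b A in qP.
  have qv : `|g v - q v| <= eps by apply: qP; rewrite inE eqxx.
  have q0 : `|g 0 - q 0| <= eps by apply: qP; rewrite !inE eqxx orbT.
  have qe i : `|g (e i) - q (e i)| <= eps.
    by apply: qP; rewrite !mem_cat map_f ?mem_enum// !orbT.
  have qn i : `|g (- e i) - q (- e i)| <= eps.
    by apply: qP; rewrite !mem_cat (map_f (fun i => - e i)) ?mem_enum// !orbT.
  have qd i j : `|g (e i + e j) - q (e i + e j)| <= eps.
    apply: qP; rewrite !mem_cat.
    by rewrite (map_f (fun ij => e ij.1 + e ij.2) (x := (i, j))) ?mem_enum// !orbT.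
  have -> : g v - interp2 g v = (g v - q v) - (interp2 g v - interp2 q v).
    by rewrite /q interp2_poly2; ring.
  apply: le_trans (ler_normB _ _) _; rewrite mulrDr mulr1 lerD//.
  (* The second difference halves a combination of four values, each off by at most [eps], so every
     coefficient is off by at most [2 * eps]. *)
  rewrite mulrCA mulrA /interp2 poly2B; apply: poly2_bound.
  - by rewrite (le_trans q0)// ler_peMl// ?ler1n// ltW.
  - move=> i; rewrite -/(e i); move: (qe i) (qn i).
    rewrite !ler_norml; lra.
  - move=> i j; rewrite -/(e i) -/(e j); move: q0 (qe i) (qe j) (qd i j).
    rewrite !ler_norml; lra.
apply/eqP; rewrite -subr_eq0 -normr_le0; apply/ler_addgt0Pl => eps eps0.
rewrite addr0; have D0 : 0 < 1 + 2 * C by lra.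
have := key (eps / (1 + 2 * C)); rewrite divfK ?gt_eqF//; apply.
by rewrite divr_gt0.
Qed.

End poly2.

(** * Partial derivatives of quadratic polynomials *)

Section poly2_derivatives.
Context (R : realType) (n : nat).
Implicit Types (c : R) (b : 'I_n -> R) (A : 'I_n -> 'I_n -> R) (x v : 'rV[R]_n).

Lemma coord_le_norm x i : `|x 0 i| <= `|x|.
Proof.
rewrite [leRHS]/Num.norm/= mx_normrE; apply/bigmax_geP; right => /=.
by exists (0, i).
Qed.

Lemma poly2_forms_bounded b A : exists2 M : R, 0 < M &
  (forall x, `|linear_form b x| <= M * `|x|) /\
  (forall x y, `|bilinear_form A x y| <= M * `|x| * `|y|).
Proof.
pose Mb : R := \sum_i `|b i|; pose MA : R := \sum_i \sum_j `|A i j|.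
have Mb0 : 0 <= Mb by exact: sumr_ge0.
have MA0 : 0 <= MA by apply: sumr_ge0 => i _; exact: sumr_ge0.
exists (1 + Mb + MA); first lra.
split=> [x|x y].
  apply: (@le_trans _ _ (Mb * `|x|)); last by rewrite ler_wpM2r//; lra.
  apply: le_trans (ler_norm_sum _ _ _) _; rewrite mulr_suml ler_sum// => i _.
  by rewrite normrM ler_wpM2l// coord_le_norm.
apply: (@le_trans _ _ (MA * `|x| * `|y|)); last first.
  by rewrite -!mulrA ler_wpM2r ?mulr_ge0//; lra.
apply: le_trans (ler_norm_sum _ _ _) _; rewrite !mulr_suml ler_sum// => i _.
apply: le_trans (ler_norm_sum _ _ _) _; rewrite !mulr_suml ler_sum// => j _.
by rewrite !normrM -mulrA ler_wpM2l// ler_pM// coord_le_norm.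
Qed.

Lemma differentiable_poly2 c b A x : differentiable (poly2 c b A : _ -> R^o) x.
Proof.
have [M M0 [bM AM]] := poly2_forms_bounded b A.
exact: (quadratic_differentiable c (linear_form_linear b)
  (bilinear_form_linearl A) (bilinear_form_linearr A) M0 bM AM).
Qed.

(** The differential comes from [quadratic_diff]. Writing the result as a [poly2] with zero
    quadratic part lets the computation be iterated. *)
Lemma derive_poly2 c b A i x :
  'D_(delta_mx 0 i) (poly2 c b A) x =
  poly2 (b i) (fun j => A j i + A i j) (fun _ _ => 0) x.
Proof.
have [M M0 [bM AM]] := poly2_forms_bounded b A.
rewrite deriveE; last exact: differentiable_poly2.
rewrite (quadratic_diff c (linear_form_linear b)
  (bilinear_form_linearl A) (bilinear_form_linearr A) M0 bM AM).
rewrite linear_form_delta bilinear_form_deltal bilinear_form_deltar.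
rewrite /poly2 [bilinear_form _ _ _]big1 ?addr0 => [|k _]; last first.
  by rewrite big1// => j _; rewrite mul0r.
congr (_ + _); rewrite /linear_form -big_split.
by apply: eq_bigr => j _; rewrite mulrDl.
Qed.

Lemma pderiv1_poly2 c b A i : 'D_(delta_mx 0 i) (poly2 c b A) =
  poly2 (b i) (fun j => A j i + A i j) (fun _ _ => 0).
Proof. by apply/funext => x; exact: derive_poly2. Qed.

Lemma pderiv_poly2 (s : seq 'I_n) c b A :
  exists c' b' A', pderiv s (poly2 c b A) = poly2 c' b' A'.
Proof.
elim: s => [|i s [c' [b' [A' IH]]]]; first by exists c, b, A.
rewrite /pderiv/= -/(pderiv s _) IH pderiv1_poly2.
by do 3 eexists.
Qed.

Lemma linear_form_eq0 b x : (forall i, b i = 0) -> linear_form b x = 0.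
Proof. by move=> b0; rewrite /linear_form big1// => i _; rewrite b0 mul0r. Qed.

Lemma bilinear_form_eq0 x y : bilinear_form (fun _ _ => 0) x y = 0.
Proof.
by rewrite /bilinear_form big1// => i _; rewrite big1// => j _; rewrite mul0r.
Qed.

Lemma pderiv2_poly2 (i j : 'I_n) c b A x :
  pderiv [:: i; j] (poly2 c b A) x = A i j + A j i.
Proof.
rewrite /pderiv/= pderiv1_poly2 derive_poly2 /poly2 bilinear_form_eq0.
by rewrite linear_form_eq0 ?addr0.
Qed.

Lemma pderiv3_poly2 (i j k : 'I_n) c b A x :
  pderiv [:: i; j; k] (poly2 c b A) x = 0.
Proof.
rewrite /pderiv/= !pderiv1_poly2 derive_poly2 /poly2 bilinear_form_eq0.
by rewrite linear_form_eq0 ?addr0.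
Qed.

Lemma Ck_poly2 k c b A : Ck k (poly2 c b A).
Proof.
split=> [s i x _|s _].
  have [c' [b' [A' ->]]] := pderiv_poly2 s c b A.
  exact/diff_derivable/differentiable_poly2.
have [c' [b' [A' ->]]] := pderiv_poly2 s c b A.
by move=> x; apply: differentiable_continuous; exact: differentiable_poly2.
Qed.

Lemma Dtensor3_poly2 c b A x : Dtensor 3 (poly2 c b A) x = 0.
Proof.
apply/ffunP => -[[|i [|j [|k []]]]// sz]; rewrite !ffunE.
exact: pderiv3_poly2.
Qed.

Lemma Linf_norm_D_lty k (g : 'rV[R]_n -> R) (a : {ffun k.-tuple 'I_n -> R}) :
  Dtensor k g = cst a -> (Linf_norm_D k g < +oo)%E.
Proof.
(* The norm is an essential supremum if the whole space has positive measure, and 0 otherwise. *)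
move=> ga; rewrite /Linf_norm_D unlock; case: ifP => // _.
apply: (@le_lt_trans _ _ (tensor_norm a)%:E); last exact: ltry.
apply/ess_supP; apply: nearW => w /=.
by rewrite ga /cst ger0_norm// sqrtr_ge0.
Qed.

Lemma Linf_norm_D2_poly2 c b A : (Linf_norm_D 2 (poly2 c b A) < +oo)%E.
Proof.
apply: (@Linf_norm_D_lty _ _ (Dtensor 2 (poly2 c b A) 0)).
apply/funext => x; apply/ffunP => -[[|i [|j []]]// sz]; rewrite !ffunE.
by rewrite !pderiv2_poly2.
Qed.

Lemma Linf_norm_D3_poly2 c b A : (Linf_norm_D 3 (poly2 c b A) < +oo)%E.
Proof.
apply: (@Linf_norm_D_lty _ _ 0); apply/funext => x.
exact: Dtensor3_poly2.
Qed.

End poly2_derivatives.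

(** * From [C^2] regularity of the functional to quadratic approximation of the integrand *)

Section approximation.
Context d (T : measurableType d) (R : realType).
Variables (mu : {measure set T -> \bar R}) (n : nat).
Hypothesis mufin : (mu setT < +oo)%E.
Hypothesis small_sets : forall e : R, 0 < e ->
  exists2 A, measurable A & (0 < mu A < e%:E)%E.

Lemma quadratic_approximation (g : 'rV[R]_n -> R) (pts : seq 'rV[R]_n) (e : R) :
  continuous g -> frechet_C2 (@integral_functional _ _ _ mu n g) -> 0 < e ->
  exists c b A, forall p, p \in pts -> `|g p - poly2 c b A p| <= e.
Proof.
move=> cg [fd [D2 [D2lin D2tay _]]] e0.
set f := integral_functional g in fd D2tay.
pose sq (p : 'rV[R]_n) : R := \sum_i p 0 i ^+ 2.
have sq0 p : 0 <= sq p by apply: sumr_ge0 => i _; exact: sqr_ge0.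
(* A common strict bound for the [sq p]. The tolerance [e / r] then yields an error of at most
   [m * e], and [m < dl ^+ 2 / r] puts every [k p] inside the ball of radius [dl], so one set [A]
   serves all of [pts]. *)
pose r : R := 1 + \sum_(p <- pts) sq p.
have r0 : 0 < r by rewrite ltr_wpDr// sumr_ge0.
have sqr p : p \in pts -> sq p < r.
  move=> pp; rewrite /r (big_rem p)//= addrCA ltrDl ltr_wpDr//.
  exact: sumr_ge0.
have er : 0 < e / r by rewrite divr_gt0.
have [D2l D2r _] := D2lin 0.
have /nbhs_norm0P[dl /= dl0 Hdl] := D2tay 0 _ er.
have [A mA /andP[A0 Adl]] : exists2 A, measurable A & (0 < mu A < (dl ^+ 2 / r)%:E)%E.
  by apply: small_sets; rewrite divr_gt0// exprn_gt0.
have muA : mu A \is a fin_num by rewrite ge0_fin_numE// (lt_trans Adl)// ltry.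
pose m : R := fine (mu A).
have m0 : 0 < m by rewrite fine_gt0// A0 ltey_eq muA.
have mdl : m < dl ^+ 2 / r by rewrite -lte_fin fineK.
pose k : 'rV[R]_n -> L2 mu n := indic_L2 mufin mA.
have kl : linear k by exact: indic_L2_linear.
(* [L] and [Q] are the Taylor terms of [f] along [k], divided by the mass [m] that also multiplies
   [g v - g 0]. *)
pose L (v : 'rV[R]_n) : R^o := 'd f 0 (k v) / m.
pose Q (v w : 'rV[R]_n) : R^o := 2^-1 * D2 0 (k v) (k w) / m.
have Ll : linear L.
  by move=> a v w; rewrite /L kl linearP mulrDl scalerAl.
have Ql w : linear (Q^~ w).
  by move=> a v v'; rewrite /Q kl D2r mulrDr mulrDl -scalerAr -scalerAl.
have Qr v : linear (Q v).
  by move=> a w w'; rewrite /Q kl D2l mulrDr mulrDl -scalerAr -scalerAl.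
exists (g 0), (fun i => L (delta_mx 0 i)), (fun i j => Q (delta_mx 0 i) (delta_mx 0 j)).
move=> p pp; rewrite /poly2 -linear_rowE// -bilinear_rowE//.
have kp : `|k p| ^+ 2 = m * sq p by exact: indic_L2_norm.
have kpdl : `|k p| < dl.
  rewrite -(@ltr_pXn2r _ 2) ?nnegrE ?(ltW dl0)// kp.
  apply: le_lt_trans (_ : m * r < _); last by rewrite -ltr_pdivlMr.
  by rewrite ler_wpM2l ?ltW// sqr.
have := @second_order_taylor _ _ f (D2 0) 0 (e / r) dl (ltW er) fd D2r _ _ kpdl.
have h1 : forall k0 h : L2 mu n, `|k0| < dl ->
  `|'d f (0 + k0) h - 'd f 0 h - D2 0 k0 h| <= e / r * `|k0| * `|h|.
  by move=> k0 h k0d; exact: Hdl.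
move=> /(_ h1); rewrite add0r kp /f integral_functional_indic// -/m -/f => h2.
have E : m * (g p - (g 0 + L p + Q p p)) =
    f 0 + m * (g p - g 0) - f 0 - 'd f 0 (k p) - 2^-1 * D2 0 (k p) (k p).
  by rewrite /L /Q; field; rewrite gt_eqF.
rewrite -(@ler_pM2l _ m)// -{1}(gtr0_norm m0) -normrM E.
apply: le_trans h2 _; rewrite mulrCA ler_pM2l// mulrAC.
by rewrite ler_pdivrMr// ler_pM2l// ltW// sqr.
Qed.

Lemma frechet_C2_integral_functional (g : 'rV[R]_n -> R) :
  continuous g -> frechet_C2 (@integral_functional _ _ _ mu n g) -> g = interp2 g.
Proof.
by move=> cg gC2; apply: poly2_limit => pts e; exact: quadratic_approximation.
Qed.

End approximation.

(** * Integral functionals of quadratic polynomials are [C^2] on [L2] *)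

Section quadratic_functionals_on_L2.
Context d (T : measurableType d) (R : realType).
Variables (mu : {measure set T -> \bar R}) (n : nat).
Hypothesis mufin : (mu setT < +oo)%E.
Local Notation V := (L2 mu n).
Local Notation F := (@integral_functional _ _ _ mu n).

Definition L2inner (u h : V) : R := inner (repr u : L2fun mu n) (repr h : L2fun mu n).

Lemma L2inner_pi (x y : L2fun mu n) :
  L2inner (\pi_V%qT x) (\pi_V%qT y) = inner x y.
Proof.
have inner_pi (z w : L2fun mu n) : inner (repr (\pi_V%qT z)) w = inner z w.
  apply/eqP; rewrite -subr_eq0; apply/eqP.
  have -> : inner (repr (\pi_V%qT z)) w - inner z w =
      inner (repr (\pi_V%qT z) + (-1) *: z) w.
    by rewrite innerDl innerZl mulN1r.
  apply: inner_null; rewrite scaleN1r inE /=.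
  have /eqP/L2_eqP := reprK (\pi_V%qT z).
  apply: filterS => t zt.
  by rewrite -[LHS]/((repr (\pi_V%qT z) : L2fun mu n) t - z t) zt subrr.
by rewrite /L2inner inner_pi innerC inner_pi innerC.
Qed.

Lemma L2innerC u h : L2inner u h = L2inner h u.
Proof. exact: innerC. Qed.

Lemma L2inner_linearl h : linear (L2inner^~ h : V -> R^o).
Proof.
move=> a; elim/quotW => x; elim/quotW => y; elim/quotW: h => z.
rewrite -[a *: _]/(L2scale a _) pi_scale -pi_addr !L2inner_pi.
by rewrite innerDl innerZl.
Qed.

Lemma L2inner_linearr u : linear (L2inner u : V -> R^o).
Proof. by move=> a x y; rewrite ![L2inner u _]L2innerC L2inner_linearl. Qed.

Lemma L2inner_bound u h : `|L2inner u h| <= `|u| * `|h|.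
Proof.
elim/quotW: u => x; elim/quotW: h => y; rewrite L2inner_pi.
rewrite [`|\pi_V%qT x|](L2norm_pi x) [`|\pi_V%qT y|](L2norm_pi y).
rewrite -sqrtrM ?inner_ge0// -sqrtr_sqr ler_wsqrtr//.
exact: CauchySchwarz_inner.
Qed.

Lemma coord_sq_integrable (i j : 'I_n) (x : L2fun mu n) :
  (fun t => x t 0 i *: delta_mx 0 j) \in @sq_integrable _ T R mu n.
Proof.
rewrite inE => k.
rewrite (_ : (fun t => _) = (delta_mx 0 j : 'rV[R]_n) 0 k \o* (fun t => x t 0 i)).
  by apply: Lfun_scale; [rewrite ler1n|exact: L2fun_coord].
by apply/funext => t; rewrite mxE.
Qed.

(** This operator sends [x] to [x_i e_j]. It turns the integral of [x_i y_j] into an inner product,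
    to which Cauchy-Schwarz applies. *)
Definition coord_L2fun i j (x : L2fun mu n) : L2fun mu n :=
  MkL2fun (coord_sq_integrable i j x).

Definition coord_L2 i j (u : V) : V := \pi_V%qT (coord_L2fun i j (repr u)).

Lemma coord_L2_pi i j (x : L2fun mu n) :
  coord_L2 i j (\pi_V%qT x) = \pi_V%qT (coord_L2fun i j x).
Proof.
apply/eqP/L2_eqP; have /eqP/L2_eqP := reprK (\pi_V%qT x).
by apply: filterS => t /= ->.
Qed.

Lemma coord_L2_linear i j : linear (coord_L2 i j).
Proof.
move=> a; elim/quotW => x; elim/quotW => y.
rewrite -[a *: \pi_V%qT x]/(L2scale a _) pi_scale -pi_addr !coord_L2_pi.
rewrite -[a *: _]/(L2scale a _) pi_scale -pi_addr; congr (\pi_V%qT _).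
apply: val_inj => /=; apply/funext => t /=.
rewrite -[LHS]/((a *: x t + y t) 0 i *: delta_mx 0 j).
rewrite -[RHS]/(a *: (x t 0 i *: delta_mx 0 j) + y t 0 i *: delta_mx 0 j).
by rewrite !mxE scalerDl scalerA.
Qed.

Lemma coord_inner i j (x y : L2fun mu n) :
  inner (coord_L2fun i j x) y = \int[mu]_t (x t 0 i * y t 0 j).
Proof.
apply: eq_Rintegral => t _ /=; rewrite (bigD1 j)//= !mxE !eqxx mulr1.
by rewrite big1 ?addr0// => k kj; rewrite !mxE (negbTE kj) andbF mulr0 mul0r.
Qed.

Lemma coord_L2_bound i j u : `|coord_L2 i j u| <= `|u|.
Proof.
elim/quotW: u => x; rewrite coord_L2_pi.
rewrite [`|\pi_V%qT (_ x)|](L2norm_pi _) [`|\pi_V%qT x|](L2norm_pi x).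
apply: ler_wsqrtr; apply: le_Rintegral => //; [exact: inner_integrable..|].
move=> t _ /=; rewrite (bigD1 j)//= !mxE !eqxx mulr1.
rewrite big1 ?addr0 => [|k kj]; last by rewrite !mxE (negbTE kj) andbF mulr0 mul0r.
by rewrite (bigD1 i)//= lerDl sumr_ge0// => k _; rewrite -expr2 sqr_ge0.
Qed.

(** The Riesz representer is the constant function [e_i], which lies in [L2] because the measure is
    finite. *)
Lemma integral_coordE i (u : V) :
  F (fun x => x 0 i) u =
  L2inner (indic_L2 mufin measurableT (delta_mx 0 i)) u.
Proof.
elim/quotW: u => x; rewrite L2inner_pi integral_functional_pi; last first.
  exact: coord_continuous.
apply: eq_Rintegral => t _ /=; rewrite indicT scale1r.
rewrite (bigD1 i)//= mxE !eqxx mul1r.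
by rewrite big1 ?addr0// => k ki; rewrite mxE (negbTE ki) andbF mul0r.
Qed.

Lemma integral_coord_mulE i j (u : V) :
  F (fun x => x 0 i * x 0 j) u = L2inner (coord_L2 i j u) u.
Proof.
elim/quotW: u => x.
rewrite coord_L2_pi L2inner_pi integral_functional_pi ?coord_inner//.
by move=> z; apply: continuousM; exact: coord_continuous.
Qed.

Lemma integral_functional_poly2 c b A (u : V) :
  F (poly2 c b A) u = c * F (fun=> 1) u + \sum_i b i * F (fun x => x 0 i) u +
    \sum_i \sum_j A i j * F (fun x => x 0 i * x 0 j) u.
Proof.
(* Integrability and the value of the integral go through one induction, since additivity at each
   step needs the integrability of the tail. *)
have int_sum (I : Type) (s : seq I) (f : I -> T -> R) (a : I -> R) :
    (forall i, mu.-integrable setT (EFin \o f i)) ->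
    mu.-integrable setT (EFin \o (fun t => \sum_(i <- s) a i * f i t)) /\
    \int[mu]_t (\sum_(i <- s) a i * f i t) = \sum_(i <- s) a i * \int[mu]_t f i t.
  move=> fi; elim: s => [|i s [IHi IH]].
    split; last first.
      by under eq_Rintegral do rewrite big_nil; rewrite Rintegral_cst// mul0r big_nil.
    rewrite (_ : _ \o _ = cst 0%E); first exact: integrable0.
    by apply/funext => t /=; rewrite big_nil.
  have ai := integrableZl measurableT (a i) (fi i).
  split.
    rewrite (_ : _ \o _ = ((fun t => (a i)%:E * (EFin \o f i) t) \+
        (EFin \o fun t => (\sum_(i <- s) a i * f i t)%R))%E).
      exact: integrableD.
    by apply/funext => t /=; rewrite big_cons EFinD EFinM.
  under eq_Rintegral do rewrite big_cons.
  by rewrite RintegralD// IH RintegralZl// big_cons.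
have i1 i : mu.-integrable setT (EFin \o (fun t => u t 0 i)).
  exact/Lfun2_integrable/L2fun_coord.
have i2 i j : mu.-integrable setT (EFin \o (fun t => u t 0 i * u t 0 j)).
  by apply/Lfun1_integrable/Lfun2_mul_Lfun1; exact: L2fun_coord.
have ic (a : R) : mu.-integrable setT (EFin \o (fun=> a)).
  exact/Lfun2_integrable/cst_Lfun2.
rewrite /integral_functional /poly2 /linear_form /bilinear_form.
have [lI lE] := int_sum _ (index_enum 'I_n) (fun i t => u t 0 i) b i1.
(* The double sum is treated as a single sum over pairs. *)
have [bI bE] := int_sum _ (index_enum ('I_n * 'I_n : finType)%type)
  (fun ij t => u t 0 ij.1 * u t 0 ij.2) (fun ij => A ij.1 ij.2)
  (fun ij => i2 ij.1 ij.2).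
under eq_Rintegral do rewrite pair_bigA/=.
rewrite RintegralD//; last first.
  rewrite (_ : _ \o _ = ((EFin \o (fun=> c)) \+
    (EFin \o (fun t => \sum_i b i * u t 0 i)%R))%E); first exact: integrableD.
  by apply/funext => t /=; rewrite EFinD.
rewrite RintegralD// lE bE !Rintegral_cst// mul1r.
by rewrite [in RHS]pair_bigA.
Qed.

Lemma integral_functional_poly2_frechet_C2 c b A : frechet_C2 (F (poly2 c b A)).
Proof.
pose w i := indic_L2 mufin measurableT (delta_mx 0 i : 'rV[R]_n) : V.
pose L (u : V) : R^o := \sum_i b i * L2inner (w i) u.
pose B (u h : V) : R^o := \sum_i \sum_j A i j * L2inner (coord_L2 i j u) h.
have -> : F (poly2 c b A) = fun u => c * fine (mu setT) + L u + B u u.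
  apply/funext => u; rewrite integral_functional_poly2; congr (_ + _ + _).
  - by rewrite /integral_functional Rintegral_cst// mul1r.
  - by apply: eq_bigr => i _; rewrite integral_coordE.
  - by apply: eq_bigr => i _; apply: eq_bigr => j _; rewrite integral_coord_mulE.
pose Mb : R := \sum_i `|b i| * `|w i|; pose MA : R := \sum_i \sum_j `|A i j|.
have Mb0 : 0 <= Mb by apply: sumr_ge0 => i _; rewrite mulr_ge0.
have MA0 : 0 <= MA by apply: sumr_ge0 => i _; exact: sumr_ge0.
(* The summand 1 keeps the bound positive when all coefficients vanish. *)
apply: (@quadratic_frechet_C2 _ _ _ L B (1 + Mb + MA)).
- move=> a u v; rewrite /L scaler_sumr -big_split; apply: eq_bigr => i _ /=.
  by rewrite L2inner_linearr mulrDr -scalerAr.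
- move=> h a u v; rewrite /B scaler_sumr -big_split; apply: eq_bigr => i _ /=.
  rewrite scaler_sumr -big_split; apply: eq_bigr => j _ /=.
  by rewrite coord_L2_linear L2inner_linearl mulrDr -scalerAr.
- move=> h a u v; rewrite /B scaler_sumr -big_split; apply: eq_bigr => i _ /=.
  rewrite scaler_sumr -big_split; apply: eq_bigr => j _ /=.
  by rewrite L2inner_linearr mulrDr -scalerAr.
- lra.
- move=> h; apply: (@le_trans _ _ (Mb * `|h|)); last by rewrite ler_wpM2r//; lra.
  apply: le_trans (ler_norm_sum _ _ _) _; rewrite mulr_suml ler_sum// => i _.
  by rewrite normrM -mulrA ler_wpM2l// L2inner_bound.
- move=> k h; apply: (@le_trans _ _ (MA * `|k| * `|h|)); last first.
    by rewrite -!mulrA ler_wpM2r ?mulr_ge0//; lra.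
  apply: le_trans (ler_norm_sum _ _ _) _; rewrite !mulr_suml ler_sum// => i _.
  apply: le_trans (ler_norm_sum _ _ _) _; rewrite !mulr_suml ler_sum// => j _.
  rewrite normrM -mulrA ler_wpM2l//; apply: le_trans (L2inner_bound _ _) _.
  by rewrite ler_wpM2r// coord_L2_bound.
Qed.

End quadratic_functionals_on_L2.

(** * The unit cube has mass 1 and contains sets of arbitrarily small positive mass *)

Section cube_measure.
Context {R : realType}.
Local Notation RM := (measurableTypeR R).

(** The slab is the product of []0, s[] and a lower dimensional cube. Taking [s = 1] gives the mass
    of the cube by induction, and small [s] gives small sets. *)
Lemma lebesgue_tuple_slab n (s : R) : 0 <= s <= 1 ->
  lebesgue_tuple R n.+1 [set w | [/\ 0 < tnth w ord0, tnth w ord0 < s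
     & forall i, 0 < tnth w i < 1]] =
  (s%:E * lebesgue_tuple R n (@cube R n))%E.
Proof.
move=> /andP[s0 s1].
rewrite /= /leb_step /pushforward.
transitivity ((@lebesgue_measure R \x lebesgue_tuple R n)%E (`]0, s[ `*` @cube R n)).
  congr (_ _); apply/seteqP; split => -[x t] /=.
    move=> [x0 xs xt]; split => /=; first by rewrite in_itv/= x0 xs.
    by move=> i; have := xt (lift ord0 i); rewrite tnthS.
  rewrite in_itv/= => -[/andP[x0 xs] ct]; split => // i.
  case: (unliftP ord0 i) => [j|] ->; first by rewrite tnthS; exact: ct.
  by rewrite tnth0 x0 (lt_le_trans xs).
rewrite product_measure1E//; last exact: measurable_cube.
congr (_ * _)%E; apply: eq_trans (lebesgue_measure_itv `]0, s[) _.
rewrite /= lte_fin; case: ltP => [_|s0']; first by rewrite sube0.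
by congr EFin; apply/le_anti; rewrite s0 s0'.
Qed.

Lemma lebesgue_tuple_cube n : lebesgue_tuple R n (@cube R n) = 1%E.
Proof.
elim: n => [|n IH].
  rewrite /= diracE mem_set// => i; by case: i.
have := @lebesgue_tuple_slab n 1; rewrite IH mule1 ler01 lexx => <-//.
congr (_ _); apply/seteqP; split => w /=.
  by move=> cw; have /andP[] := cw ord0.
by case.
Qed.

Lemma lebesgue_cubeT n : lebesgue_cube R n setT = 1%E.
Proof.
by rewrite /lebesgue_cube/= /mrestr setTI lebesgue_tuple_cube.
Qed.

(** Thin slabs in the first coordinate do it. In dimension 0 the measure is a Dirac mass, with no
    set of mass strictly between 0 and 1. *)
Lemma lebesgue_cube_small_sets n (e : R) : (0 < n)%N -> 0 < e ->
  exists2 A : set (n.-tuple RM), measurable A & (0 < lebesgue_cube R n A < e%:E)%E.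
Proof.
case: n => // n _ e0; pose s := Num.min 1 (e / 2).
have s0 : 0 < s by rewrite lt_min ltr01 divr_gt0.
have s1 : s <= 1 by rewrite ge_min lexx.
have se : s < e by rewrite gt_min; apply/orP; right; rewrite gtr_pMr// invf_lt1// ltr1n.
exists ((@tnth _ RM ^~ ord0) @^-1` `]0, s[%classic).
  by rewrite -[X in measurable X]setTI; exact: measurable_tnth.
rewrite /lebesgue_cube/= /mrestr.
rewrite (_ : _ `&` _ = [set w | [/\ 0 < tnth w ord0, tnth w ord0 < s
     & forall i, 0 < tnth w i < 1]]); last first.
  apply/seteqP; split => w /=.
    by rewrite in_itv/= => -[/andP[]].
  by move=> [a b c]; split => //; rewrite in_itv/= a b.
rewrite lebesgue_tuple_slab ?(ltW s0)// lebesgue_tuple_cube mule1.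
by rewrite !lte_fin s0.
Qed.

End cube_measure.

(** * From the interpolation formula to a finite spanning family *)

Lemma finite_dim_space_span (R : realType) (V : Type) (I : finType)
    (e : I -> V -> R) :
  finite_dim_space [set f | exists c : I -> R, f = fun x => \sum_i c i * e i x].
Proof.
exists #|I|, (fun k => e (enum_val k)); apply/seteqP; split=> f /= [c ->].
  exists (c \o enum_val); apply/funext => x.
  by rewrite (reindex _ (onW_bij _ (enum_val_bij I))).
exists (c \o enum_rank); apply/funext => x.
rewrite [RHS](reindex _ (onW_bij _ (enum_val_bij I))).
by apply: eq_bigr => k _ /=; rewrite enum_valK.
Qed.

Lemma frechet_C2_Phi (R : realType) (d : nat) (g : 'rV[R]_d -> R) : (0 < d)%N ->
  continuous g -> frechet_C2 (@Phi R d g) -> g = interp2 g.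
Proof.
move=> hd; have mufin : (lebesgue_cube R d setT < +oo)%E.
  by rewrite lebesgue_cubeT ltry.
apply: (frechet_C2_integral_functional mufin) => e e0.
exact: lebesgue_cube_small_sets.
Qed.

Unset Implicit Arguments.

Theorem propositionA4 (R : realType) (d : nat) (hd : (0 < d)%N) :
  [set f : L2cube R d -> R | frechet_C2 f] `&`
  [set @Phi R d g | g in
    [set g | [/\ Ck 3 g, (Linf_norm_D 2 g < +oo)%E, (Linf_norm_D 3 g < +oo)%E
               & exists x, Dtensor 3 g x <> 0]]] = set0
  /\
  finite_dim_space
    ([set f : L2cube R d -> R | frechet_C2 f] `&`
     [set @Phi R d g | g in
       [set g | [/\ Ck 3 g, (Linf_norm_D 2 g < +oo)%E
                  & (Linf_norm_D 3 g < +oo)%E]]]).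
Proof.
have mufin : (lebesgue_cube R d setT < +oo)%E by rewrite lebesgue_cubeT ltry.
have C2_quadratic g : Ck 3 g -> frechet_C2 (@Phi R d g) -> g = interp2 g.
  (* The empty list of derivatives in [Ck 3 g] is the continuity of [g] itself. *)
  by move=> [_ cg]; apply: frechet_C2_Phi => //; exact: (cg [::]).
split.
  apply/seteqP; split=> // f [/= fC2 [g [gC3 _ _ [x D3g]] gf]]; apply: D3g.
  rewrite -gf in fC2; rewrite (C2_quadratic g gC3 fC2).
  exact: Dtensor3_poly2.
(* Indices of the monomials [1], [x_i] and [x_i x_j]. Both orders of a pair occur, which is harmless
   since only a spanning family is required. *)
pose I : finType := (unit + ('I_d + 'I_d * 'I_d))%type.
pose mono (k : I) : 'rV[R]_d -> R := match k with
  | inl _ => fun=> 1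
  | inr (inl i) => fun x => x 0 i
  | inr (inr (i, j)) => fun x => x 0 i * x 0 j
  end.
rewrite (_ : _ `&` _ = [set f | exists c : I -> R,
    f = fun x => \sum_k c k * @Phi R d (mono k) x]).
  exact: finite_dim_space_span.
have Phi_poly2 c b A : @Phi R d (poly2 c b A) = fun u => \sum_(k : I)
    match k with
    | inl _ => c
    | inr (inl i) => b i
    | inr (inr (i, j)) => A i j
    end * @Phi R d (mono k) u.
  apply/funext => u.
  transitivity (integral_functional (poly2 c b A) u) => //.
  rewrite integral_functional_poly2// !big_sumType/= -addrA; congr (_ + (_ + _)).
    by rewrite (big_pred1 tt)// => -[].
  by rewrite pair_bigA; apply: eq_bigr => -[i j] _.
apply/seteqP; split=> f /=.
  move=> [fC2 [g [gC3 _ _] gf]]; rewrite -gf in fC2.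
  by rewrite -gf (C2_quadratic g gC3 fC2) /interp2 Phi_poly2; eexists.
move=> [c ->].
(* Conversely, the coefficients of a combination assemble into one quadratic polynomial, whose
   functional is [C^2] and whose derivative tensors of orders 2 and 3 are constant. *)
pose q := poly2 (c (inl tt)) (fun i => c (inr (inl i))) (fun i j => c (inr (inr (i, j)))).
have -> : (fun x => \sum_k c k * Phi (mono k) x) = @Phi R d q.
  rewrite Phi_poly2; apply/funext => u; apply: eq_bigr => k _.
  by case: k => [[]|[i|[i j]]].
split; first exact: integral_functional_poly2_frechet_C2.
exists q => //; split; first exact: Ck_poly2.
  exact: Linf_norm_D2_poly2.
exact: Linf_norm_D3_poly2.
Qed.
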